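(* For $i=1,2$ consider forward complete systems $\Sigma_i:\ \frac{d}{dt}x_i(t)=f_i(x_i(t),w_i(t))$ with $x_i(0)\in\mathbb{R}^{n_i}$, $w_i\in\mathcal{W}^{m_i}$, where $f_i:\mathbb{R}^{n_i}\times\mathbb{R}^{m_i}\to\mathbb{R}^{n_i}$ is locally Lipschitz in its first argument, locally uniformly in its second argument, and $m_1=n_2$. Suppose both systems are iISS with functions $\alpha_i,\beta_i,\gamma_i,\sigma_i\in\mathcal{K}_\infty$: $$\int_0^t\alpha_i(|x_i(\tau)|)d\tau\le\max\left\{\beta_i(|x_i(0)|),\ \gamma_i\left(\int_0^t\sigma_i(|w_i(\tau)|)d\tau\right)\right\}$$ for all $x_i(0)\in\mathbb{R}^{n_i}$, $w_i\in\mathcal{W}^{m_i}$, $t\ge0$. Suppose the systems are connected in cascade with $w_1=x_2$. If there exists $c>0$ such that $$\sigma_1(s)\le c\,\alpha_2(s)\quad\text{for all }s\in\mathbb{R}_{\ge0},$$ then the cascade interconnection is iISS (from input $w_2$ to state $x=[x_1^T\ x_2^T]^T$); that is, there exist $\alpha,\beta,\gamma,\sigma\in\mathcal{K}_\infty$ such that $$\int_0^t\alpha(|x(\tau)|)d\tau\le\max\left\{\beta(|x(0)|),\ \gamma\left(\int_0^t\sigma(|w_2(\tau)|)d\tau\right)\right\}$$ for all $x(0)\in\mathbb{R}^{n_1+n_2}$, $w_2\in\mathcal{W}^{m_2}$, $t\ge0$.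
   Context: $\mathcal{W}^m$ is the set of measurable, locally essentially bounded functions $w:\mathbb{R}_{\ge0}\to\mathbb{R}^m$. Forward complete means that for every initial condition and every input in the input class the solution exists for all $t\ge 0$. $\mathcal{K}_\infty$ is the class of continuous, strictly increasing, unbounded functions $\alpha:\mathbb{R}_{\ge0}\to\mathbb{R}_{\ge0}$ with $\alpha(0)=0$. $|\cdot|$ is the Euclidean norm. iISS stands for integral input-to-state stable. *)

(* Defs.v *)
From HB Require Import structures.
From mathcomp Require Import all_boot all_order all_algebra.
From mathcomp Require Import all_classical all_reals all_analysis.
Set Implicit Arguments.
Unset Strict Implicit.
Unset Printing Implicit Defensive.
Import Order.TTheory GRing.Theory Num.Theory.
Import numFieldNormedType.Exports.
Local Open Scope classical_set_scope.
Local Open Scope ring_scope.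

(* The library norm on matrices is the max norm. *)
Definition enorm (R : realType) (n : nat) (v : 'cV[R]_n) : R :=
  Num.sqrt (\sum_(i < n) v i 0 ^+ 2).

(* Functions on R_{>=0} are represented by functions on R; only their values
   on [0, +oo[ are ever constrained. *)

Definition class_Kinf (R : realType) (a : R -> R) : Prop :=
  [/\ a 0 = 0,
      {within `[0, +oo[, continuous a},
      {in `[0, +oo[ &, {homo a : s t / s < t}}
    & forall M : R, exists2 s : R, 0 <= s & M < a s].

(* R with the sigma-algebra of Lebesgue (not only Borel) measurable sets: the
   domain of completed_lebesgue_measure. *)
Notation lebesgueTypeR R := (caratheodory_type (wlength (@idfun R))^*%mu).

Definition input (R : realType) (m : nat) (w : R -> 'cV[R]_m) : Prop :=
  (forall i : 'I_m,
     measurable_fun (`[0, +oo[ : set (lebesgueTypeR R)) (fun t : R => w t i 0)) /\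
  (forall T : R, exists M : R,
     {ae @completed_lebesgue_measure R, forall t, t \in `[0, T] -> enorm (w t) <= M}).

Definition abs_continuous_on (R : realType) (n : nat) (a b : R)
    (x : R -> 'cV[R]_n) : Prop :=
  forall e : R, 0 < e -> exists2 d : R, 0 < d &
    forall (k : nat) (s t : 'I_k -> R),
      (forall i, [/\ a <= s i, s i <= t i & t i <= b]) ->
      (forall i j, i != j -> t i <= s j \/ t j <= s i) ->
      \sum_(i < k) (t i - s i) < d ->
      \sum_(i < k) enorm (x (t i) - x (s i)) < e.

(* Caratheodory solution on [0, +oo[ of dx/dt = f(x, w). *)
Definition solution (R : realType) (n m : nat)
    (f : 'cV[R]_n -> 'cV[R]_m -> 'cV[R]_n)
    (w : R -> 'cV[R]_m) (x : R -> 'cV[R]_n) : Prop :=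
  (forall T : R, 0 <= T -> abs_continuous_on 0 T x) /\
  {ae @completed_lebesgue_measure R,
     forall t : R, 0 <= t -> is_derive t 1 x (f (x t) (w t))}.

Definition locally_lipschitz1 (R : realType) (n m : nat)
    (f : 'cV[R]_n -> 'cV[R]_m -> 'cV[R]_n) : Prop :=
  forall (x0 : 'cV[R]_n) (w0 : 'cV[R]_m), exists r L : R, 0 < r /\
    forall (x y : 'cV[R]_n) (w : 'cV[R]_m),
      enorm (x - x0) < r -> enorm (y - x0) < r -> enorm (w - w0) < r ->
      enorm (f x w - f y w) <= L * enorm (x - y).

Definition forward_complete (R : realType) (n m : nat)
    (f : 'cV[R]_n -> 'cV[R]_m -> 'cV[R]_n) : Prop :=
  forall (x0 : 'cV[R]_n) (w : R -> 'cV[R]_m), input w ->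
    exists2 x : R -> 'cV[R]_n, solution f w x & x 0 = x0.

Definition iISS_with (R : realType) (n m : nat)
    (f : 'cV[R]_n -> 'cV[R]_m -> 'cV[R]_n) (a b g s : R -> R) : Prop :=
  let mu := @completed_lebesgue_measure R in
  forall (w : R -> 'cV[R]_m) (x : R -> 'cV[R]_n) (t : R),
    input w -> solution f w x -> 0 <= t ->
    \int[mu]_(tau in `[0, t]) a (enorm (x tau)) <=
      Num.max (b (enorm (x 0)))
              (g (\int[mu]_(tau in `[0, t]) s (enorm (w tau)))).

Definition iISS (R : realType) (n m : nat)
    (f : 'cV[R]_n -> 'cV[R]_m -> 'cV[R]_n) : Prop :=
  exists a b g s : R -> R,
    [/\ class_Kinf a, class_Kinf b, class_Kinf g, class_Kinf s
      & iISS_with f a b g s].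

(* State [x1; x2], input w2; x2 is fed as the input of the first system. *)
Definition cascade (R : realType) (n1 n2 m2 : nat)
    (f1 : 'cV[R]_n1 -> 'cV[R]_n2 -> 'cV[R]_n1)
    (f2 : 'cV[R]_n2 -> 'cV[R]_m2 -> 'cV[R]_n2)
    (x : 'cV[R]_(n1 + n2)) (w : 'cV[R]_m2) : 'cV[R]_(n1 + n2) :=
  col_mx (f1 (usubmx x) (dsubmx x)) (f2 (dsubmx x) w).

(* Main.v *)
Require Import Defs.
From mathcomp Require Import all_boot all_order all_algebra.
From mathcomp Require Import all_classical all_reals all_analysis.
From mathcomp Require Import measurable_realfun lra.
Import Order.TTheory GRing.Theory Num.Theory.
Import numFieldNormedType.Exports.
Local Open Scope classical_set_scope.
Local Open Scope ring_scope.

(* Feeding the estimate of the driving system Sigma_2 into that of Sigma_1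
   through sigma_1 <= c alpha_2 bounds both integrals of alpha_i(|x_i|) by a
   function of |x(0)| plus a function of the input energy, and
   P + Q <= max (2 P) (2 Q).  The state estimate follows with
   alpha(s) = min (alpha_1 (s/2), alpha_2 (s/2)).  The trajectory x_2 is an
   admissible input of Sigma_1 because it is continuous. *)

Set Implicit Arguments.
Unset Strict Implicit.
Unset Printing Implicit Defensive.

(** K-infinity functions are continuous only relative to [[0, +oo[], so composing them requires the
    inner map to send [A] into [B]; a relative neighbourhood in [B] then pulls back to one in
    [A]. *)
Lemma continuous_within_comp (T U V : topologicalType) (A : set T) (B : set U)
    (f : T -> U) (g : U -> V) :
  (forall x, A x -> B (f x)) ->
  {within A, continuous f} -> {within B, continuous g} ->
  {within A, continuous (g \o f)}.
Proof.
move=> fAB /subspace_continuousP cf /subspace_continuousP cg.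
apply/subspace_continuousP => x Ax W gW.
have gBW : nbhs (f x) [set y | B y -> W (g y)] := cg _ (fAB _ Ax) _ gW.
have := cf _ Ax _ gBW; rewrite /= !nbhs_simpl /within /=.
apply: filterS => z /= gWz Az.
exact: gWz Az (fAB _ Az).
Qed.

(** * Closure properties of K-infinity functions *)

Section class_Kinf_theory.
Variable R : realType.
Implicit Types a b g : R -> R.

Lemma class_Kinf_le a (s t : R) :
  class_Kinf a -> 0 <= s -> s <= t -> a s <= a t.
Proof.
move=> [_ _ incr _] s0; rewrite le_eqVlt => /predU1P[->//|st].
apply/ltW/incr => //; rewrite in_itv/= andbT //.
exact: le_trans (ltW st).
Qed.

Lemma class_Kinf_ge0 a (s : R) : class_Kinf a -> 0 <= s -> 0 <= a s.
Proof. by move=> Ka s0; case: (Ka) => <- _ _ _; exact: class_Kinf_le. Qed.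

Lemma class_Kinf_comp a b :
  class_Kinf a -> class_Kinf b -> class_Kinf (a \o b).
Proof.
move=> Ka Kb; case: (Ka) (Kb) => [a0 ca incra unba] [b0 cb incrb unbb].
split => [||s t s0 t0 st|M] /=.
- by rewrite b0.
- apply: continuous_within_comp cb ca => s /=.
  by rewrite !in_itv/= !andbT; exact: class_Kinf_ge0.
- move: (s0) (t0); rewrite !in_itv/= !andbT => s0' t0'.
  apply: incra; last exact: incrb.
  + by rewrite in_itv/= andbT; exact: class_Kinf_ge0.
  + by rewrite in_itv/= andbT; exact: class_Kinf_ge0.
- have [u u0 Mu] := unba M; have [s s0 us] := unbb u; exists s => //.
  by apply: lt_le_trans Mu _; exact: class_Kinf_le (ltW us).
Qed.

Lemma class_KinfD a b :
  class_Kinf a -> class_Kinf b -> class_Kinf (fun s => a s + b s).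
Proof.
move=> Ka Kb; case: (Ka) (Kb) => [a0 ca incra unba] [b0 cb incrb unbb].
split => [||s t s0 t0 st|M] /=.
- by rewrite a0 b0 addr0.
- by move=> x; apply: (@cvgD _ _ (subspace _)); [exact: ca|exact: cb].
- by rewrite ltrD ?incra ?incrb.
- have [s s0 Ms] := unba M; exists s => //.
  by rewrite (lt_le_trans Ms)// lerDl; exact: class_Kinf_ge0.
Qed.

Lemma class_Kinf_scale (k : R) : 0 < k -> class_Kinf ( *%R k).
Proof.
move=> k0; split => [||s t _ _ st|M].
- by rewrite mulr0.
- by apply: continuous_subspaceT => x; exact: mulrl_continuous.
- by rewrite ltr_pM2l.
(* The absolute value keeps the witness nonnegative whatever the sign of [M]; its image is
   [|M| + 1]. *)
- exists ((`|M| + 1) / k); first by rewrite divr_ge0 ?addr_ge0// ltW.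
  by rewrite mulrCA divff ?gt_eqF// mulr1 ltr_pwDr// ler_norm.
Qed.

Lemma class_Kinf_min a b :
  class_Kinf a -> class_Kinf b -> class_Kinf (fun s => Num.min (a s) (b s)).
Proof.
move=> Ka Kb; case: (Ka) (Kb) => [a0 ca incra unba] [b0 cb incrb unbb].
split => [||s t s0 t0 st|M] /=.
- by rewrite a0 b0 minxx.
- by move=> x; apply: (@continuous_min _ (subspace _)); [exact: ca|exact: cb].
- by rewrite lt_min !gt_min incra ?incrb// orbT.
- have [s s0 Ms] := unba M; have [t t0 Mt] := unbb M.
  exists (Num.max s t); first by rewrite le_max s0.
  by rewrite lt_min (lt_le_trans Ms) ?(lt_le_trans Mt)// class_Kinf_le// le_max
    lexx ?orbT.
Qed.

End class_Kinf_theory.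

(** * The Euclidean norm and stacked vectors *)

Section enorm_theory.
Variable R : realType.

Lemma enorm_ge0 n (v : 'cV[R]_n) : 0 <= enorm v.
Proof. exact: sqrtr_ge0. Qed.

Lemma sqr_enorm n (v : 'cV[R]_n) : enorm v ^+ 2 = \sum_(i < n) v i 0 ^+ 2.
Proof. by rewrite sqr_sqrtr// sumr_ge0// => i _; exact: sqr_ge0. Qed.

Lemma normr_coord_le_enorm n (v : 'cV[R]_n) i : `|v i 0| <= enorm v.
Proof.
rewrite -ler_sqr ?nnegrE ?enorm_ge0 ?normr_ge0// real_normK ?num_real//.
rewrite sqr_enorm (bigD1 i)//= lerDl sumr_ge0// => j _; exact: sqr_ge0.
Qed.

Lemma sqr_enorm_submx n1 n2 (v : 'cV[R]_(n1 + n2)) :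
  enorm v ^+ 2 = enorm (usubmx v) ^+ 2 + enorm (dsubmx v) ^+ 2.
Proof.
rewrite !sqr_enorm big_split_ord/=.
by congr (_ + _); apply: eq_bigr => i _; rewrite !mxE.
Qed.

Lemma enorm_usubmx n1 n2 (v : 'cV[R]_(n1 + n2)) : enorm (usubmx v) <= enorm v.
Proof.
rewrite -ler_sqr ?nnegrE ?enorm_ge0// [leRHS]sqr_enorm_submx.
by rewrite lerDl sqr_ge0.
Qed.

Lemma enorm_dsubmx n1 n2 (v : 'cV[R]_(n1 + n2)) : enorm (dsubmx v) <= enorm v.
Proof.
rewrite -ler_sqr ?nnegrE ?enorm_ge0// [leRHS]sqr_enorm_submx.
by rewrite lerDr sqr_ge0.
Qed.

(** After squaring, the two sides differ by the cross term [2 |x_1| |x_2|], which is nonnegative. *)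
Lemma enorm_le_submxD n1 n2 (v : 'cV[R]_(n1 + n2)) :
  enorm v <= enorm (usubmx v) + enorm (dsubmx v).
Proof.
rewrite -ler_sqr ?nnegrE ?addr_ge0 ?enorm_ge0// sqr_enorm_submx sqrrD.
by rewrite lerD2r lerDl mulrn_wge0// mulr_ge0// enorm_ge0.
Qed.

Lemma enorm_continuous_within (T : topologicalType) (A : set T) n
    (x : T -> 'cV[R]_n) :
  (forall i, {within A, continuous (fun t => x t i 0)}) ->
  {within A, continuous (@enorm _ _ \o x)}.
Proof.
move=> cx t; apply: (@continuous_comp (subspace A) _ _ _ Num.sqrt); last first.
  exact: sqrt_continuous.
apply: (@continuous_big _ _ _ _ _ add_continuous (subspace A)) => i _ {}t.
apply: (@cvg_comp _ _ _ (fun s => x s i 0) (fun r => r ^+ 2)); first exact: cx.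
exact: exprn_continuous.
Qed.

End enorm_theory.

(** * Regularity of trajectories and splitting of cascade solutions *)

Section trajectories.
Variable R : realType.
Notation mu := (@completed_lebesgue_measure R).

(** Continuity gives Borel preimages, whereas inputs and [mu] live on the Lebesgue sigma-algebra;
    this is the passage from one to the other. *)
Lemma measurable_lebesgueTypeR (A : set R) :
  measurable (A : set (measurableTypeR R)) ->
  measurable (A : set (lebesgueTypeR R)).
Proof. exact: sub_caratheodory. Qed.

Lemma continuous_within_measurable (A : set R) (f : R -> R) :
  measurable (A : set (measurableTypeR R)) -> {within A, continuous f} ->
  measurable_fun (A : set (lebesgueTypeR R)) f.
Proof.
move=> mA cf _ Y mY; apply: measurable_lebesgueTypeR.
exact: (subspace_continuous_measurable_fun mA cf).
Qed.

(** A continuous function is bounded on the compact interval, which has finite measure. *)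
Lemma continuous_within_integrable (t : R) (f : R -> R) :
  {within `[0, +oo[, continuous f} ->
  mu.-integrable `[0, t] (EFin \o f).
Proof.
move=> /(@continuous_subspaceW _ _ `[0, t]) cf.
have {}cf : {within `[0, t], continuous f}.
  by apply: cf => s /=; rewrite !in_itv/= => /andP[->].
apply: measurable_bounded_integrable.
- exact: measurable_lebesgueTypeR.
(* On the interval [mu] agrees by conversion with [lebesgue_measure], whose length formula shows
   finiteness. *)
- have := lebesgue_measure_itv `[0, t]; rewrite /= lte_fin => muE.
  by apply: (@le_lt_trans _ _ (lebesgue_measure (`[0, t] : set R))) => //;
    rewrite muE; case: ifP => _; rewrite ltry.
- exact: continuous_within_measurable.
- have /compact_bounded[M [_ mrt]] :=
    continuous_compact cf (@segment_compact _ _ _).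
  by exists M; split; rewrite ?num_real // => ? ? ? ?; exact: mrt.
Qed.

(** Absolute continuity applied to a one-interval family is uniform continuity, and a coordinate of
    an increment is bounded by its norm. *)
Lemma abs_continuous_on_coord n (x : R -> 'cV[R]_n) :
  (forall T, 0 <= T -> abs_continuous_on 0 T x) ->
  forall i, {within `[0, +oo[, continuous (fun t => x t i 0)}.
Proof.
move=> acx i; apply/subspace_continuousP => t; rewrite /= in_itv/= andbT => t0.
apply/cvgrPdist_lt => e e0.
(* The horizon [t + 1] leaves room to the right of [t], so that points on both sides of [t] are
   covered. *)
have [|d d0 xd] := acx (t + 1) _ e e0; first by rewrite addr_ge0.
have short p q : 0 <= p -> p <= q -> q <= t + 1 -> q - p < d ->
    `|x q i 0 - x p i 0| < e.
  move=> p0 pq qt pqd; have := xd 1 (fun=> p) (fun=> q).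
  rewrite !big_ord1; move=> /(_ (fun=> And3 p0 pq qt)) xpq.
  apply: le_lt_trans (xpq _ pqd); last by move=> j k; rewrite !ord1 eqxx.
  by apply: le_trans (normr_coord_le_enorm _ i); rewrite !mxE.
rewrite near_withinE; near=> s => /=; rewrite in_itv/= andbT => s0.
have std : `|t - s| < d by near: s; exact: nbhsx_ballx.
have st1 : `|t - s| < 1 by near: s; exact: nbhsx_ballx.
have [st|/ltW ts] := leP s t.
  by apply: short => //; [rewrite ler_wpDr|exact: le_lt_trans (ler_norm _) std].
rewrite distrC; apply: short => //.
  move: st1; rewrite distrC => /(le_lt_trans (ler_norm _))/ltW.
  by rewrite lerBlDl.
by move: std; rewrite distrC; exact: le_lt_trans (ler_norm _).
Unshelve. all: by end_near. Qed.

Lemma solution_continuous n m f (w : R -> 'cV[R]_m) (x : R -> 'cV[R]_n) :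
  solution f w x -> forall i, {within `[0, +oo[, continuous (fun t => x t i 0)}.
Proof. by case=> /abs_continuous_on_coord. Qed.

(** Supplies the integrability under which the real-valued integrals along trajectories can be
    compared, scaled and added. *)
Lemma class_Kinf_solution_integrable n m f (w : R -> 'cV[R]_m)
    (x : R -> 'cV[R]_n) (a : R -> R) (t : R) :
  class_Kinf a -> solution f w x ->
  mu.-integrable `[0, t] (EFin \o (fun tau => a (enorm (x tau)))).
Proof.
move=> [_ ca _ _] /solution_continuous cx; apply: continuous_within_integrable.
apply: (continuous_within_comp _ (enorm_continuous_within cx) ca) => s _ /=.
by rewrite in_itv/= andbT enorm_ge0.
Qed.

Lemma solution_input n m f (w : R -> 'cV[R]_m) (x : R -> 'cV[R]_n) :
  solution f w x -> input x.
Proof.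
move=> /solution_continuous cx; split => [i|T].
  exact: continuous_within_measurable.
(* For negative [T] the interval is empty and any bound does; otherwise the extreme value theorem
   gives one. *)
have [T0|T0] := ltP T 0.
  exists 0; apply: aeW => t; rewrite in_itv/= => /andP[t0 tT].
  by have := lt_le_trans (le_lt_trans tT T0) t0; rewrite ltxx.
have [|c _ xc] := @EVT_max _ (@enorm _ _ \o x) 0 T T0.
  apply: continuous_subspaceW (enorm_continuous_within cx) => s /=.
  by rewrite !in_itv/= => /andP[->].
by exists (enorm (x c)); apply: aeW => t; exact: xc.
Qed.

Lemma is_derive_mxP n (x : R -> 'cV[R]_n) (t : R) (v : 'cV[R]_n) :
  is_derive t 1 x v <-> forall i, is_derive t 1 (fun s => x s i 0) (v i 0).
Proof.
split=> [xv i|xv].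
  have dx : derivable x t 1 by [].
  split; first by move/derivable_mxP : dx; exact.
  by rewrite -[v](@derive_val _ _ _ _ _ _ _ xv) derive_mx// mxE.
have dx : derivable x t 1.
  by apply/derivable_mxP => i j; rewrite ord1; have [] := xv i.
split=> //; rewrite derive_mx//; apply/matrixP => i j; rewrite !mxE ord1.
exact: derive_val.
Qed.

Lemma abs_continuous_on_le n p (a b : R) (x : R -> 'cV[R]_n)
    (y : R -> 'cV[R]_p) :
  (forall s t, enorm (y t - y s) <= enorm (x t - x s)) ->
  abs_continuous_on a b x -> abs_continuous_on a b y.
Proof.
move=> yx acx e e0; have [d d0 xd] := acx e e0; exists d => // k s t st disj std.
by apply: le_lt_trans (xd _ _ _ st disj std); apply: ler_sum => i _; exact: yx.
Qed.

Lemma abs_continuous_on_col_mx n1 n2 (a b : R) (x : R -> 'cV[R]_(n1 + n2)) :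
  abs_continuous_on a b (usubmx \o x) -> abs_continuous_on a b (dsubmx \o x) ->
  abs_continuous_on a b x.
Proof.
move=> ac1 ac2 e e0; have e2 : 0 < e / 2 by rewrite divr_gt0.
have [d d0 xd] := ac1 _ e2; have [d' d'0 xd'] := ac2 _ e2.
exists (Num.min d d'); first by rewrite lt_min d0.
move=> k s t st disj; rewrite lt_min => /andP[std std'].
rewrite (splitr e).
apply: le_lt_trans (ltrD (xd _ _ _ st disj std) (xd' _ _ _ st disj std')).
rewrite -big_split/=; apply: ler_sum => i _.
by rewrite (le_trans (enorm_le_submxD _))// !raddfB.
Qed.

(** Taking a block does not increase the norm of an increment, and the norm of a stacked increment
    is at most the sum of the block norms, so absolute continuity transfers both ways. Derivatives
    are compared coordinatewise, outside null sets. *)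
Lemma solution_cascadeP n1 n2 m2
    (f1 : 'cV[R]_n1 -> 'cV[R]_n2 -> 'cV[R]_n1)
    (f2 : 'cV[R]_n2 -> 'cV[R]_m2 -> 'cV[R]_n2)
    (w : R -> 'cV[R]_m2) (x : R -> 'cV[R]_(n1 + n2)) :
  solution (cascade f1 f2) w x <->
  solution f1 (dsubmx \o x) (usubmx \o x) /\ solution f2 w (dsubmx \o x).
Proof.
have aeF : Filter (nbhs (almost_everywhere mu)) := ae_filter_ringOfSetsType mu.
split=> [[acx dx]|[[ac1 dx1] [ac2 dx2]]].
  split; split.
  - move=> T /acx; apply: abs_continuous_on_le => s t /=.
    by rewrite -raddfB enorm_usubmx.
  - apply: filterS dx => t xt /xt/is_derive_mxP {}xt; apply/is_derive_mxP => i.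
    (* Rebuilding [x s] from its two blocks under the binder identifies this coordinate with one of
       the upper block. *)
    have := xt (lshift _ i); rewrite /cascade col_mxEu /=.
    by under [in X in X -> _]eq_fun do rewrite -[x _]vsubmxK col_mxEu.
  - move=> T /acx; apply: abs_continuous_on_le => s t /=.
    by rewrite -raddfB enorm_dsubmx.
  - apply: filterS dx => t xt /xt/is_derive_mxP {}xt; apply/is_derive_mxP => i.
    have := xt (rshift _ i); rewrite /cascade col_mxEd /=.
    by under [in X in X -> _]eq_fun do rewrite -[x _]vsubmxK col_mxEd.
split.
  by move=> T T0; apply: abs_continuous_on_col_mx; [exact: ac1|exact: ac2].
apply: filterS2 dx1 dx2 => t xt1 xt2 t0; apply/is_derive_mxP => i.
have /is_derive_mxP {}xt1 := xt1 t0; have /is_derive_mxP {}xt2 := xt2 t0.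
rewrite /cascade; case: (split_ordP i) => j ->.
  rewrite col_mxEu; under eq_fun do rewrite -[x _]vsubmxK col_mxEu.
  exact: xt1.
rewrite col_mxEd; under eq_fun do rewrite -[x _]vsubmxK col_mxEd.
exact: xt2.
Qed.

(** * Forward completeness and iISS of the cascade *)

Section cascade_theory.
Variables (n1 n2 m2 : nat).
Variables (f1 : 'cV[R]_n1 -> 'cV[R]_n2 -> 'cV[R]_n1).
Variables (f2 : 'cV[R]_n2 -> 'cV[R]_m2 -> 'cV[R]_n2).

(** The driving system is solved first; its trajectory is then an admissible input for the driven
    one, and the two solutions are stacked. *)
Lemma forward_complete_cascade :
  forward_complete f1 -> forward_complete f2 ->
  forward_complete (cascade f1 f2).
Proof.
move=> fc1 fc2 x0 w iw; have [x2 sol2 x20] := fc2 (dsubmx x0) w iw.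
have [x1 sol1 x10] := fc1 (usubmx x0) x2 (solution_input sol2).
exists (fun t => col_mx (x1 t) (x2 t)); last by rewrite x10 x20 vsubmxK.
apply/solution_cascadeP.
have -> : usubmx \o (fun t => col_mx (x1 t) (x2 t)) = x1.
  by apply/funext => t /=; rewrite col_mxKu.
have -> // : dsubmx \o (fun t => col_mx (x1 t) (x2 t)) = x2.
by apply/funext => t /=; rewrite col_mxKd.
Qed.

Lemma iISS_cascade (a1 b1 g1 s1 a2 b2 g2 s2 : R -> R) (c : R) :
  class_Kinf a1 -> class_Kinf b1 -> class_Kinf g1 -> class_Kinf s1 ->
  class_Kinf a2 -> class_Kinf b2 -> class_Kinf g2 -> class_Kinf s2 ->
  iISS_with f1 a1 b1 g1 s1 -> iISS_with f2 a2 b2 g2 s2 ->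
  0 < c -> (forall s, 0 <= s -> s1 s <= c * a2 s) ->
  iISS (cascade f1 f2).
Proof.
move=> Ka1 Kb1 Kg1 Ks1 Ka2 Kb2 Kg2 Ks2 iISS1 iISS2 c0 s1a2.
have Kscale (k : R) : 0 < k -> class_Kinf ( *%R k) by exact: class_Kinf_scale.
pose a s := Num.min (a1 (2^-1 * s)) (a2 (2^-1 * s)).
have Ka : class_Kinf a.
  have h : 0 < 2^-1 :> R by rewrite invr_gt0.
  by apply: class_Kinf_min; [have := class_Kinf_comp Ka1 (Kscale _ h)
                            |have := class_Kinf_comp Ka2 (Kscale _ h)].
(* The terms [b1] and [g1 (c * _)] come from the estimate of the driven system, the terms [b2] and
   [g2] from that of the driving one; the factor 2 separates initial state from input energy. *)
exists a, (fun s => 2 * (b1 s + g1 (c * b2 s) + b2 s)).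
exists (fun s => 2 * (g1 (c * g2 s) + g2 s)), s2; split => //.
- apply: (class_Kinf_comp (Kscale 2 (ltr0Sn _ _))).
  do 2! apply: class_KinfD => //.
  exact: (class_Kinf_comp Kg1 (class_Kinf_comp (Kscale _ c0) Kb2)).
- apply: (class_Kinf_comp (Kscale 2 (ltr0Sn _ _))); apply: class_KinfD => //.
  exact: (class_Kinf_comp Kg1 (class_Kinf_comp (Kscale _ c0) Kg2)).
move=> w x t iw sol t0.
have /solution_cascadeP[sol1 sol2] := sol.
have mt : measurable (`[0, t] : set (lebesgueTypeR R)).
  exact: measurable_lebesgueTypeR.
set u := \int[mu]_(tau in _) _ (enorm (w tau)).
have u0 : 0 <= u.
  by apply: Rintegral_ge0 => tau _; rewrite class_Kinf_ge0 ?enorm_ge0.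
set r := enorm (x 0); have r0 : 0 <= r := enorm_ge0 _.
pose I1 := \int[mu]_(tau in `[0, t]) a1 (enorm (usubmx (x tau))).
pose I2 := \int[mu]_(tau in `[0, t]) a2 (enorm (dsubmx (x tau))).
have int1 := class_Kinf_solution_integrable t Ka1 sol1.
have int2 := class_Kinf_solution_integrable t Ka2 sol2.
have I2_ge0 : 0 <= I2.
  by apply: Rintegral_ge0 => tau _; rewrite class_Kinf_ge0 ?enorm_ge0.
have I2_le : I2 <= Num.max (b2 r) (g2 u).
  apply: le_trans (iISS2 _ _ _ iw sol2 t0) _.
  rewrite ge_max !le_max lexx orbT andbT.
  by rewrite class_Kinf_le ?enorm_ge0 ?enorm_dsubmx.
(* The gain condition, integrated along [x_2], bounds the input energy received by the driven
   system. *)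
have s1_le : \int[mu]_(tau in `[0, t]) s1 (enorm (dsubmx (x tau))) <= c * I2.
  rewrite -RintegralZl//; apply: le_Rintegral => //.
  - exact: (class_Kinf_solution_integrable t Ks1 sol2).
  - have Kca2 := class_Kinf_comp (Kscale _ c0) Ka2.
    exact: (class_Kinf_solution_integrable t Kca2 sol2).
  - by move=> tau _; rewrite s1a2 ?enorm_ge0.
have I1_le : I1 <= Num.max (b1 r) (Num.max (g1 (c * b2 r)) (g1 (c * g2 u))).
  apply: le_trans (iISS1 _ _ _ (solution_input sol2) sol1 t0) _.
  rewrite ge_max; apply/andP; split.
    by rewrite le_max class_Kinf_le ?enorm_ge0 ?enorm_usubmx.
  rewrite le_max; apply/orP; right.
  apply: (@le_trans _ _ (g1 (c * I2))).
    apply: class_Kinf_le => //; apply: Rintegral_ge0 => tau _.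
    by rewrite class_Kinf_ge0 ?enorm_ge0.
  have cI2 : 0 <= c * I2 by rewrite mulr_ge0// ltW.
  (* Since [g1] is monotone and [c] positive, whichever term bounds [I2] passes through
     [g1 (c * _)]. *)
  by move: I2_le; rewrite !le_max => /orP[] I2_le; apply/orP; [left|right];
    rewrite class_Kinf_le// ler_pM2l.
(* Merging the two integrals reduces the claim to a pointwise inequality. *)
have I12 : \int[mu]_(tau in `[0, t]) a (enorm (x tau)) <= I1 + I2.
  rewrite -RintegralD//; apply: le_Rintegral => //.
  - exact: (class_Kinf_solution_integrable t Ka sol).
  - by have := integrableD mt int1 int2.
  - move=> tau _.
    have p1 : 0 <= a1 (enorm (usubmx (x tau))).
      by rewrite class_Kinf_ge0 ?enorm_ge0.
    have p2 : 0 <= a2 (enorm (dsubmx (x tau))).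
      by rewrite class_Kinf_ge0 ?enorm_ge0.
    have hx : 0 <= 2^-1 * enorm (x tau) by rewrite mulr_ge0 ?enorm_ge0.
    have xD := enorm_le_submxD (x tau).
    (* The larger of the two substates is at least [enorm x / 2]. *)
    rewrite ge_min.
    have [le12|/ltW le21] :=
      leP (enorm (usubmx (x tau))) (enorm (dsubmx (x tau))).
      by rewrite orbC ler_wpDl// class_Kinf_le//; lra.
    by rewrite ler_wpDr// class_Kinf_le//; lra.
apply: le_trans I12 _.
have := class_Kinf_ge0 Kb1 r0; have := class_Kinf_ge0 Kb2 r0.
have := class_Kinf_ge0 Kg2 u0.
have : 0 <= g1 (c * b2 r).
  by rewrite class_Kinf_ge0// mulr_ge0 ?(ltW c0)// class_Kinf_ge0.
have : 0 <= g1 (c * g2 u).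
  by rewrite class_Kinf_ge0// mulr_ge0 ?(ltW c0)// class_Kinf_ge0.
move=> ? ? ? ? ?; rewrite le_max.
(* With [P] the state terms and [Q] the input terms, nonnegativity lets sums replace the maxima, so
   [I1 + I2 <= P + Q]; the larger of [P] and [Q] selects the branch of the final maximum. *)
have [PQ|/ltW QP] := leP (b1 r + g1 (c * b2 r) + b2 r) (g1 (c * g2 u) + g2 u).
  apply/orP; right; move: I1_le I2_le; rewrite !le_max; lra.
apply/orP; left; move: I1_le I2_le; rewrite !le_max; lra.
Qed.

End cascade_theory.

End trajectories.

Theorem theorem9 (R : realType) (n1 n2 m2 : nat)
  (f1 : 'cV[R]_n1 -> 'cV[R]_n2 -> 'cV[R]_n1)
  (f2 : 'cV[R]_n2 -> 'cV[R]_m2 -> 'cV[R]_n2)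
  (a1 b1 g1 s1 a2 b2 g2 s2 : R -> R)
  (lip1 : locally_lipschitz1 f1) (lip2 : locally_lipschitz1 f2)
  (fc1 : forward_complete f1) (fc2 : forward_complete f2)
  (Ka1 : class_Kinf a1) (Kb1 : class_Kinf b1)
  (Kg1 : class_Kinf g1) (Ks1 : class_Kinf s1)
  (Ka2 : class_Kinf a2) (Kb2 : class_Kinf b2)
  (Kg2 : class_Kinf g2) (Ks2 : class_Kinf s2)
  (iISS1 : iISS_with f1 a1 b1 g1 s1) (iISS2 : iISS_with f2 a2 b2 g2 s2)
  (gain : exists2 c : R, 0 < c & forall s : R, 0 <= s -> s1 s <= c * a2 s) :
  forward_complete (cascade f1 f2) /\ iISS (cascade f1 f2).
Proof.
split; first exact: forward_complete_cascade.
by have [c c0 s1a2] := gain; apply: iISS_cascade iISS1 iISS2 c0 s1a2.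
Qed.
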